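(* Let $\mathcal{X}_{f,g}$ be a curve over $\mathbb{F}_q$ with rational points $P_1,\ldots,P_{a+1}$ satisfying the hypotheses listed in the context, let $2\leq m\leq a+1$, assume $q\geq m$, and let $\mathbf{P}_m=(P_1,\ldots,P_m)$. For $i=1,\ldots,b-1$, let $S_{i1}$ be the set of all $m$-tuples $$\left(a(b-i)-b(1+j),\beta_2,\ldots,\beta_m\right)\in\mathbb{N}_0^m$$ for which $j\in\{0,\ldots,\lfloor\frac{a(b-i)-b}{b}\rfloor\}$ and there exist $d_2,\ldots,d_m\in\mathbb{N}_0$ with $\beta_t<i+bd_t$ for $t=2,\ldots,m$ and $\sum_{t=2}^m d_t=j$. For each $2\leq k\leq m$, let $S_{ik}$ be the set of all $m$-tuples $$(\beta_1,\ldots,\beta_{k-1},i+bj,\beta_{k+1},\ldots,\beta_m)\in\mathbb{N}_0^m$$ (with $i+bj$ in the $k$-th coordinate) for which $j\in\{0,\ldots,\lfloor\frac{a(b-i)-b}{b}\rfloor\}$ and there exist $d_t\in\mathbb{N}_0$, for $t\in\{1,\ldots,m\}\setminus\{k\}$, with $\beta_t<i+bd_t$ for $t\in\{2,\ldots,m\}\setminus\{k\}$, $\beta_1<a(b-i)-b(1+d_1)$, and $d_1-\sum_{t=2,\,t\neq k}^m d_t=j$. Then the set of Weierstrass gaps of $\mathcal{X}_{f,g}$ at $\mathbf{P}_m$ is $$G(\mathbf{P}_m)=\bigcup_{i=1}^{b-1}\left(\bigcup_{k=1}^m S_{ik}\right).$$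
   Context: $\mathbb{N}_0$ is the set of nonnegative integers; when the upper bound $\lfloor\frac{a(b-i)-b}{b}\rfloor$ is negative the range of $j$ is empty. Hypotheses on the curve: $\mathcal{X}_{f,g}$ is a nonsingular, projective, geometrically irreducible algebraic curve over $\mathbb{F}_q$ of positive genus, admitting a plane model of type $f(y)=g(x)$, where $f(T),g(T)\in\mathbb{F}_q[T]$ with $\deg f=a$, $\deg g=b$ and $\gcd(a,b)=1$; its genus is $(a-1)(b-1)/2$. There are $a+1$ distinct rational points $P_1,\ldots,P_{a+1}$ on $\mathcal{X}_{f,g}$ such that $aP_1\sim P_2+\cdots+P_{a+1}$ and $bP_1\sim bP_j$ for all $j\in\{2,\ldots,a+1\}$, where $b$ is the smallest positive integer satisfying the latter condition, and $\sim$ is linear equivalence of divisors. Gaps: $H(\mathbf{P}_m)=\{(\alpha_1,\ldots,\alpha_m)\in\mathbb{N}_0^m : \exists\, h\in\mathbb{F}_q(\mathcal{X}_{f,g})^\times \text{ with } \mathrm{div}_\infty(h)=\sum_{i=1}^m\alpha_iP_i\}$, where $\mathrm{div}_\infty(h)$ is the divisor of poles of $h$, and $G(\mathbf{P}_m)=\mathbb{N}_0^m\setminus H(\mathbf{P}_m)$. *)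

(* Defs.v *)
From HB Require Import structures.
From mathcomp Require Import all_boot all_order all_algebra all_field.
From mathcomp Require Import polyXY boolp classical_sets.
From mathcomp Require Export freeg.

Set Implicit Arguments.
Unset Strict Implicit.
Unset Printing Implicit Defensive.

Import Order.TTheory GRing.Theory Num.Theory.
Local Open Scope ring_scope.
Local Open Scope classical_set_scope.

(* A nonsingular projective curve X over k is represented by its function field
   F = k(X), with iota : k -> F the inclusion of the constants; its closed
   points are the normalised discrete valuations of F that are trivial on k
   (the abstract nonsingular curve of F/k, Hartshorne I.6). *)

(* [place_ord Q z] is the order of z at the point Q.  The order of 0, which is
   +oo, is encoded by the junk value 0, so that a valuation is
   determined by the function [place_ord]; z = 0 is always treated apart. *)
Record place (k F : fieldType) (iota : {rmorphism k -> F}) := Place {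
  place_ord :> F -> int;
  place_ord0 : place_ord 0 = 0;
  place_ordM : forall u v : F, u != 0 -> v != 0 ->
    place_ord (u * v) = place_ord u + place_ord v;
  place_ordD : forall u v : F, u != 0 -> v != 0 -> u + v != 0 ->
    Num.min (place_ord u) (place_ord v) <= place_ord (u + v);
  place_ord_const : forall c : k, place_ord (iota c) = 0;
  place_ord_norm : exists t, place_ord t = 1 }.

HB.instance Definition _ (k F : fieldType) (iota : {rmorphism k -> F}) :=
  gen_eqMixin (place iota).
HB.instance Definition _ (k F : fieldType) (iota : {rmorphism k -> F}) :=
  gen_choiceMixin (place iota).

Section FunctionField.
Variables (k F : fieldType) (iota : {rmorphism k -> F}).

Notation divisor := {freeg (place iota) / int}.

Definition lincomb n (c : 'I_n -> k) (e : 'I_n -> F) : F :=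
  \sum_(i < n) iota (c i) * e i.

(* The quotient of the k-subspace U by the k-subspace W has dimension n. *)
Definition has_qdim (U W : set F) (n : nat) : Prop :=
  exists e : 'I_n -> F,
    [/\ forall i, U (e i),
        forall u, U u -> exists c, W (u - lincomb c e)
      & forall c, W (lincomb c e) -> forall i, c i = 0].

(* The value is 0 when the dimension is infinite. *)
Definition qdim (U W : set F) : nat := xget 0%N (has_qdim U W).

Definition local_ring (Q : place iota) : set F :=
  [set z | z = 0 \/ 0 <= Q z].

Definition maximal_ideal (Q : place iota) : set F :=
  [set z | z = 0 \/ 0 < Q z].

Definition place_deg (Q : place iota) : nat :=
  qdim (local_ring Q) (maximal_ideal Q).

Definition rational_point (Q : place iota) : Prop := place_deg Q = 1%N.

(* [freeg.deg] would not weight the points by their degrees. *)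
Definition div_deg (D : divisor) : int :=
  \sum_(Q <- dom D) coeff Q D * (place_deg Q)%:Z.

Definition riemann_roch_space (D : divisor) : set F :=
  [set z | z = 0 \/ forall Q : place iota, 0 <= Q z + coeff Q D].

Definition rr_dim (D : divisor) : nat := qdim (riemann_roch_space D) [set 0].

(* gamma = max { deg D - l(D) + 1 : D a divisor } *)
Definition has_genus (gamma : nat) : Prop :=
  (forall D : divisor, div_deg D - (rr_dim D)%:Z + 1 <= gamma%:Z) /\
  (exists D : divisor, div_deg D - (rr_dim D)%:Z + 1 = gamma%:Z).

Definition lin_equiv (D E : divisor) : Prop :=
  exists2 h : F, h != 0 &
    forall Q : place iota, coeff Q D - coeff Q E = Q h.

(* The divisor of poles of h is D. *)
Definition is_pole_divisor (h : F) (D : divisor) : Prop :=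
  forall Q : place iota, Num.max 0 (- Q h) = coeff Q D.

(* k is algebraically closed in F; as the finite field k is perfect, this is
   the geometric irreducibility of the curve. *)
Definition geom_irreducible : Prop :=
  forall z : F, algebraicOver iota z -> exists c : k, z = iota c.

(* The value p(x, y) of p = p(X, Y), where the outer variable 'X is X and the
   inner variable 'X%:P is Y. *)
Definition eval_xy (x y : F) (p : {poly {poly k}}) : F :=
  (map_poly (map_poly iota) p).[x, y].

(* F is the fraction field of the coordinate ring k[X, Y] / (f(Y) - g(X)), with
   x and y the classes of X and Y: the curve is birational to f(y) = g(x). *)
Definition plane_model (f g : {poly k}) (x y : F) : Prop :=
  (forall p : {poly {poly k}}, eval_xy x y p = 0 <->
     exists r, p = r * (f%:P - map_poly polyC g)) /\
  (forall z : F, exists p r : {poly {poly k}},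
     eval_xy x y r != 0 /\ z = eval_xy x y p / eval_xy x y r).

Definition weierstrass_semigroup m (P : 'I_m -> place iota) :
    set {ffun 'I_m -> nat} :=
  [set alpha : {ffun 'I_m -> nat} | exists2 h : F, h != 0 &
     is_pole_divisor h (\sum_(i < m) << P i >> *+ alpha i)].

Definition weierstrass_gaps m (P : 'I_m -> place iota) :
    set {ffun 'I_m -> nat} :=
  ~` weierstrass_semigroup P.

End FunctionField.

Section GapSets.
Variables (a b m : nat).
(* [o] is the index of the first coordinate. *)
Variable o : 'I_m.

(* [divz] by b > 0 is the floor of the quotient. *)
Definition jmax (i : nat) : int :=
  ((a%:Z * (b%:Z - i%:Z) - b%:Z) %/ b%:Z)%Z.

Definition gap_set_first (i : nat) : set {ffun 'I_m -> nat} :=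
  [set beta : {ffun 'I_m -> nat} | exists (j : nat) (d : 'I_m -> nat),
     [/\ j%:Z <= jmax i,
         (beta o)%:Z = a%:Z * (b%:Z - i%:Z) - b%:Z * (1 + j%:Z),
         forall t : 'I_m, t != o -> (beta t < i + b * d t)%N
       & (\sum_(t < m | t != o) d t)%N = j]].

Definition gap_set_other (i : nat) (l : 'I_m) : set {ffun 'I_m -> nat} :=
  [set beta : {ffun 'I_m -> nat} | exists (j : nat) (d : 'I_m -> nat),
     [/\ j%:Z <= jmax i,
         beta l = (i + b * j)%N,
         forall t : 'I_m, t != o -> t != l -> (beta t < i + b * d t)%N,
         (beta o)%:Z < a%:Z * (b%:Z - i%:Z) - b%:Z * (1 + (d o)%:Z)
       & (d o)%:Z - \sum_(t < m | (t != o) && (t != l)) (d t)%:Z = j%:Z]].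

Definition gap_set (i : nat) (l : 'I_m) : set {ffun 'I_m -> nat} :=
  if l == o then gap_set_first i else gap_set_other i l.

End GapSets.

(* Main.v *)
From HB Require Import structures.
Require Import Defs.
From mathcomp Require Import all_boot all_order all_algebra all_field.
From mathcomp Require Import boolp classical_sets.
From mathcomp Require Import zify ring.

Set Implicit Arguments.
Unset Strict Implicit.
Unset Printing Implicit Defensive.

Import Order.TTheory GRing.Theory Num.Theory.
Local Open Scope ring_scope.
Local Open Scope classical_set_scope.

(* Let u have divisor P_2 + ... + P_(a+1) - a P_1 and v_t have divisor
   b P_t - b P_1.  The genus bound and its sharpness give l(n P_1) = n + 1 - gamma
   for large n, and as gamma = (a-1)(b-1)/2 is the number of gaps of <a, b>, the
   monomials u^i v_t^e with i < b span the functions regular outside P_1.  These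
   monomials have distinct orders at P_1, and also at P_t, so such a function has
   no pole of order a(b-1) - bs with s > 0 at P_1, and if it has order b-1 at P_t
   then it has a pole of order at least a(b-1) at P_1.

   As #|k| >= m, alpha is a gap iff for some l no function of L(A), where
   A = sum alpha_t P_t, has order exactly - alpha_l at P_l.  Given h in L(A), let
   M = u^r prod v_t^(e_t) with r < b fixed by the residue of alpha_l modulo b and
   each e_t least possible; then h / M * u^(b-1) is regular outside P_1, and the
   two facts above show that alpha_l is attained iff M, up to a power of some v_t,
   attains it.  With i = b - r and d_t = - e_t this is the description of S_il. *)

(** * Dimensions of quotients of subspaces of F *)

Section LinearAlgebra.
Variables (k F : fieldType) (iota : {rmorphism k -> F}).

Definition subspace (W : set F) : Prop :=
  [/\ W 0, forall u v, W u -> W v -> W (u + v)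
    & forall c u, W u -> W (iota c * u)].

Definition independent n (e : 'I_n -> F) : Prop :=
  forall c : 'I_n -> k, lincomb iota c e = 0 -> forall i, c i = 0.

Lemma subspace0 : subspace [set 0].
Proof.
by split=> [//|u v -> ->|c u ->] /=; rewrite ?addr0 ?mulr0.
Qed.

Lemma subspaceB W u v : subspace W -> W u -> W v -> W (u - v).
Proof.
case=> _ WD WZ Wu Wv; apply: WD => //.
by have := WZ (-1) _ Wv; rewrite rmorphN1 mulN1r.
Qed.

Lemma subspaceZI W c u : subspace W -> c != 0 -> W (iota c * u) -> W u.
Proof.
case=> _ _ WZ c0 /(WZ c^-1).
by rewrite mulrA -rmorphM mulVf // rmorph1 mul1r.
Qed.

Lemma subspace_sum W (I : Type) (r : seq I) (Q : pred I) (E : I -> F) :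
  subspace W -> (forall i, Q i -> W (E i)) -> W (\sum_(i <- r | Q i) E i).
Proof. by case=> W0 WD _ WE; apply: (big_ind W). Qed.

Lemma subspace_lincomb W n (c : 'I_n -> k) e :
  subspace W -> (forall i, W (e i)) -> W (lincomb iota c e).
Proof.
by move=> Wsub We; apply: subspace_sum => // i _; case: Wsub => _ _; apply.
Qed.

Lemma lincomb_mul N n (c : 'I_N -> k) (A : 'M[k]_(N, n)) (e : 'I_n -> F) :
  lincomb iota c (fun i => lincomb iota (A i) e) =
  lincomb iota (((\row_i c i) *m A) 0) e.
Proof.
rewrite /lincomb.
under eq_bigr => i _ do rewrite mulr_sumr.
rewrite exchange_big /=; apply: eq_bigr => j _.
rewrite !mxE rmorph_sum mulr_suml; apply: eq_bigr => i _.
by rewrite !mxE rmorphM mulrA.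
Qed.

Lemma qdim_coord U W n N (v : 'I_N -> F) :
    has_qdim iota U W n -> (forall i, U (v i)) ->
  exists e : 'I_n -> F, exists A : 'M[k]_(N, n),
    forall i, W (v i - lincomb iota (A i) e).
Proof.
case=> e [_ Ugen _] Uv; exists e.
have [A AP] := choice (fun i => Ugen _ (Uv i)).
exists (\matrix_(i, j) A i j) => i.
suff -> : lincomb iota ((\matrix_(i, j) A i j) i) e = lincomb iota (A i) e by [].
by apply: eq_bigr => j _; congr (iota _ * _); apply: mxE.
Qed.

Lemma lincombB n (c : 'I_n -> k) e e' :
  lincomb iota c (fun i => e i - e' i) = lincomb iota c e - lincomb iota c e'.
Proof. by rewrite /lincomb -sumrB; apply: eq_bigr => i _; rewrite mulrBr. Qed.

Lemma lincomb0 n (c : 'I_n -> k) e :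
  (forall i, c i = 0) -> lincomb iota c e = 0.
Proof.
by move=> c0; rewrite /lincomb big1 // => i _; rewrite c0 rmorph0 mul0r.
Qed.

(** The coordinates modulo [W] form an N x n matrix, which has a nonzero left kernel vector when n <
    N. *)
Lemma qdim_dependent U W n N (v : 'I_N -> F) :
    subspace W -> has_qdim iota U W n -> (forall i, U (v i)) -> (n < N)%N ->
  exists c : 'I_N -> k, (exists i, c i != 0) /\ W (lincomb iota c v).
Proof.
move=> Wsub UW Uv ltnN; have [e [A AP]] := qdim_coord UW Uv.
have : kermx A != 0.
  rewrite -mxrank_eq0 mxrank_ker subn_eq0 -ltnNge.
  exact: leq_ltn_trans (rank_leq_col A) ltnN.
case/rowV0Pn => c /sub_kermxP cA /rV0Pn cn0.
exists (c 0); split => //.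
have : W (lincomb iota (c 0) (fun i => v i - lincomb iota (A i) e)).
  exact: subspace_lincomb.
have rowE : \row_i c 0 i = c by apply/rowP => i; rewrite mxE.
rewrite lincombB lincomb_mul rowE.
by rewrite cA [X in _ - X]lincomb0 ?subr0 // => i; rewrite mxE.
Qed.

Lemma independent_le U n N (v : 'I_N -> F) :
  has_qdim iota U [set 0] n -> (forall i, U (v i)) -> independent v ->
  (N <= n)%N.
Proof.
move=> UW Uv indv; rewrite leqNgt; apply/negP => ltnN.
have [c [[i ci] /indv /(_ i) c0]] := qdim_dependent subspace0 UW Uv ltnN.
by rewrite c0 eqxx in ci.
Qed.

Definition fcons n (u : F) (e : 'I_n -> F) : 'I_n.+1 -> F :=
  fun i => if unlift ord0 i is Some j then e j else u.

Lemma fconsP (A : set F) n u (e : 'I_n -> F) :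
  A u -> (forall i, A (e i)) -> forall i, A (fcons u e i).
Proof. by move=> Au Ae i; rewrite /fcons; case: unlift. Qed.

Lemma lincomb_fcons n c u (e : 'I_n -> F) :
  lincomb iota c (fcons u e) =
  iota (c ord0) * u + lincomb iota (fun i => c (lift ord0 i)) e.
Proof.
rewrite /lincomb big_ord_recl {1}/fcons unlift_none; congr (_ + _).
by apply: eq_bigr => i _; rewrite /fcons liftK.
Qed.

Lemma dependent_span n u (e : 'I_n -> F) :
  independent e -> ~ independent (fcons u e) ->
  exists c, u = lincomb iota c e.
Proof.
move=> inde /existsNP[c /not_implyP[ce /existsNP[i /eqP ci]]].
move: ce; rewrite lincomb_fcons.
have [c0|c0 /eqP] := eqVneq (c ord0) 0.
  rewrite c0 rmorph0 mul0r add0r => /inde ce.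
  by move: ci; case: (unliftP ord0 i) => [j|] ->; rewrite ?ce ?c0 eqxx.
rewrite addr_eq0 => /eqP cu; exists (fun i => - (c ord0)^-1 * c (lift ord0 i)).
apply: (mulfI (x := iota (c ord0))); first by rewrite fmorph_eq0.
rewrite cu /lincomb mulr_sumr -sumrN; apply: eq_bigr => j _.
by rewrite mulrA -rmorphM mulrA mulrN divff // mulN1r rmorphN mulNr.
Qed.

(** An independent family of maximal length is a basis; the bound [N] ensures that a maximal length
    exists. *)
Lemma has_qdim_bounded U N :
    (forall n (e : 'I_n -> F), (forall i, U (e i)) -> independent e ->
      (n <= N)%N) ->
  exists n, has_qdim iota U [set 0] n.
Proof.
move=> bnd.
pose Q n := `[< exists e : 'I_n -> F, (forall i, U (e i)) /\ independent e >].
have Q0 : exists n, Q n.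
  exists 0%N; apply/asboolP; exists (fun=> 0).
  by split=> [[]|c _ []].
have QN n : Q n -> (n <= N)%N.
  by move=> /asboolP[e [Ue inde]]; apply: bnd Ue inde.
have [n /asboolP[e [Ue inde]] nmax] := ex_maxnP Q0 QN.
exists n, e; split=> // u Uu.
have [indue|/(dependent_span inde)[c ->]] := pselect (independent (fcons u e)).
  have /nmax : Q n.+1.
    by apply/asboolP; exists (fcons u e); split => //; apply: fconsP.
  by rewrite ltnn.
by exists c; rewrite /= subrr.
Qed.

Lemma has_qdim_indep U n :
  has_qdim iota U [set 0] n ->
  exists2 e : 'I_n -> F, forall i, U (e i) & independent e.
Proof. by case=> e [Ue _ inde]; exists e. Qed.

Lemma has_qdim_inj U n n' :
  has_qdim iota U [set 0] n -> has_qdim iota U [set 0] n' -> n = n'.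
Proof.
move=> Un Un'; apply/eqP; rewrite eqn_leq.
have [e Ue inde] := has_qdim_indep Un.
have [e' Ue' inde'] := has_qdim_indep Un'.
by rewrite (independent_le Un' Ue inde) (independent_le Un Ue' inde').
Qed.

Lemma independentZ n (e : 'I_n -> F) z :
  z != 0 -> independent e -> independent (fun i => z * e i).
Proof.
move=> z0 inde c ce; apply: inde; apply: (mulfI z0).
rewrite mulr0 -[RHS]ce /lincomb mulr_sumr; apply: eq_bigr => i _.
by rewrite mulrCA.
Qed.

Lemma has_qdim_sub U V z n :
    z != 0 -> (forall u, U u -> V (z * u)) -> has_qdim iota V [set 0] n ->
  exists2 n', has_qdim iota U [set 0] n' & (n' <= n)%N.
Proof.
move=> z0 UV Vn.
have bnd n' (e : 'I_n' -> F) :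
    (forall i, U (e i)) -> independent e -> (n' <= n)%N.
  move=> Ue /(independentZ z0); apply: independent_le Vn _ => i.
  exact: UV.
have [n' Un'] := has_qdim_bounded bnd; exists n' => //.
by have [e Ue inde] := has_qdim_indep Un'; apply: bnd Ue inde.
Qed.

(* Rank-nullity for the multiplication by z from U to V / W. *)
Lemma has_qdim_quot U V W U' z n n' d :
    subspace U -> subspace W ->
    has_qdim iota U [set 0] n -> has_qdim iota V W d ->
    has_qdim iota U' [set 0] n' ->
    (forall u, U u -> V (z * u)) ->
    (forall u, U u -> W (z * u) -> U' u) ->
  (n <= n' + d)%N.
Proof.
move=> Usub Wsub Un VW Un' UV UU'.
have [e Ue inde] := has_qdim_indep Un.
have [eps [B BP]] := qdim_coord VW (fun i => UV _ (Ue i)).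
(* The rows of [K] are the coordinates of a basis of the vectors that multiplication by [z] sends
   into [W]. *)
pose K := row_base (kermx B).
suff : (\rank (kermx B) <= n')%N.
  rewrite mxrank_ker leq_subLR addnC => /leq_trans-> //.
  by rewrite leq_add2l rank_leq_col.
apply: (independent_le Un' (v := fun i => lincomb iota (K i) e)) => [i|c].
  apply: UU'; first exact: subspace_lincomb.
  have : W (lincomb iota (K i) (fun i => z * e i - lincomb iota (B i) eps)).
    exact: subspace_lincomb.
  have rowE : \row_j K i j = row i K by apply/rowP => j; rewrite !mxE.
  rewrite lincombB lincomb_mul rowE.
  have -> : row i K *m B = 0.
    by apply/sub_kermxP; apply: submx_trans (row_sub _ _) _; rewrite eq_row_base.
  rewrite [X in _ - X]lincomb0 => [|j]; last by rewrite mxE.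
  rewrite subr0 /lincomb mulr_sumr.
  by under eq_bigr => j _ do rewrite mulrCA.
rewrite lincomb_mul => /inde cK0 i.
have /row_freeP[K' KK'] : row_free K := row_base_free _.
have /(congr1 (mulmx^~ K')) : (\row_i c i) *m K = 0.
  by apply/rowP => j; rewrite cK0 mxE.
by rewrite /= -mulmxA KK' mulmx1 mul0mx => /rowP/(_ i); rewrite !mxE.
Qed.

Lemma independent_basis U n (e : 'I_n -> F) u :
    has_qdim iota U [set 0] n -> (forall i, U (e i)) -> independent e -> U u ->
  exists c, u = lincomb iota c e.
Proof.
move=> Un Ue inde Uu; apply: dependent_span => // indue.
have := independent_le Un (fconsP Uu Ue) indue; by rewrite ltnn.
Qed.

End LinearAlgebra.

(** * Orders at a place *)

Section Places.
Variables (k F : fieldType) (iota : {rmorphism k -> F}).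
Implicit Types (Q : place iota) (u v z : F).

Lemma ord1 Q : Q 1 = 0.
Proof. by rewrite -(rmorph1 iota) place_ord_const. Qed.

Lemma ordV Q u : u != 0 -> Q u^-1 = - Q u.
Proof.
move=> u0; apply/eqP; rewrite -addr_eq0 addrC -place_ordM ?invr_eq0 //.
by rewrite divff // ord1.
Qed.

Lemma ord_exp Q u n : u != 0 -> Q (u ^+ n) = n%:Z * Q u.
Proof.
move=> u0; elim: n => [|n IHn]; first by rewrite expr0 ord1 mul0r.
by rewrite exprS place_ordM ?expf_neq0 // IHn; lia.
Qed.

Lemma ord_exprz Q u (n : int) : u != 0 -> Q (u ^ n) = n * Q u.
Proof.
move=> u0; case: n => n; first by rewrite -exprnP ord_exp.
by rewrite NegzE -exprnN ordV ?expf_neq0 // ord_exp // mulNr.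
Qed.

Lemma ordZ Q c u : c != 0 -> u != 0 -> Q (iota c * u) = Q u.
Proof. by move=> c0 u0; rewrite place_ordM ?fmorph_eq0 // place_ord_const add0r. Qed.

Lemma ord_prod Q (I : Type) (r : seq I) (A : pred I) (E : I -> F) :
  (forall i, E i != 0) ->
  \prod_(i <- r | A i) E i != 0 /\
  Q (\prod_(i <- r | A i) E i) = \sum_(i <- r | A i) Q (E i).
Proof.
move=> E0; elim/big_rec2: _ => [|i z n _ [n0 IH]].
  by rewrite oner_eq0 ord1.
by rewrite mulf_neq0 // place_ordM // IH.
Qed.

Definition ord_ge Q (n : int) : set F := [set z | z = 0 \/ n <= Q z].

Lemma ord_ge_subspace Q n : subspace iota (ord_ge Q n).
Proof.
split=> [|u v|c u]; first by left.
  move=> [->|Hu]; first by rewrite add0r.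
  move=> [->|Hv]; first by rewrite addr0; right.
  have [->|u0] := eqVneq u 0; first by rewrite add0r; right.
  have [->|v0] := eqVneq v 0; first by rewrite addr0; right.
  have [->|uv0] := eqVneq (u + v) 0; [by left | right].
  by apply: le_trans (place_ordD Q u0 v0 uv0); rewrite le_min Hu.
have [->|c0] := eqVneq c 0; first by rewrite rmorph0 mul0r; left.
have [->|u0] := eqVneq u 0; first by rewrite mulr0; left.
move=> [->|Hu]; first by rewrite mulr0; left.
by right; rewrite ordZ.
Qed.

Lemma ord_geP Q n z : z != 0 -> ord_ge Q n z <-> n <= Q z.
Proof. by move=> /eqP z0; split=> [[]|]; [| |right]. Qed.

(** The ultrametric inequality for u = (u + v) + (-v) gives the bound opposite to the one for u + v.
    Writing the hypothesis with [ord_ge] lets v be 0. *)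
Lemma ordD_lt Q u v :
  u != 0 -> ord_ge Q (Q u + 1) v -> u + v != 0 /\ Q (u + v) = Q u.
Proof.
move=> u0 [->|Hv]; first by rewrite addr0.
have [v0|v0] := eqVneq v 0; first by rewrite v0 addr0.
have uv0 : u + v != 0.
  apply/eqP => /eqP; rewrite addr_eq0 => /eqP uv.
  have := ordZ Q (c := -1) (u := v); rewrite oppr_eq0 oner_eq0 rmorphN1 mulN1r -uv.
  by move=> /(_ isT v0) uvQ; lia.
split=> //.
have := place_ordD Q u0 v0 uv0.
have : Num.min (Q (u + v)) (Q (- v)) <= Q u.
  by have := @place_ordD _ _ _ Q (u + v) (- v); rewrite addrK oppr_eq0; apply.
have : Q (- v) = Q v.
  rewrite -[RHS](@ordZ Q (-1)) ?oppr_eq0 ?oner_eq0 //.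
  by rewrite rmorphN1 mulN1r.
lia.
Qed.

(** With distinct orders, the term of least order among those with nonzero coefficient dominates the
    sum, by [ordD_lt]. *)
Lemma ord_lincomb Q n (e : 'I_n -> F) c i :
    (forall i, e i != 0) -> injective (fun i => Q (e i)) -> c i != 0 ->
  [/\ lincomb iota c e != 0, Q (lincomb iota c e) <= Q (e i)
    & exists2 j, c j != 0 & Q (lincomb iota c e) = Q (e j)].
Proof.
move=> e0 einj ci.
case: (@arg_minP _ _ _ i (fun j => c j != 0) (fun j => Q (e j)) ci) => j cj jmin.
have Hj : iota (c j) * e j != 0 by rewrite mulf_neq0 ?fmorph_eq0.
have : ord_ge Q (Q (iota (c j) * e j) + 1) (\sum_(l | l != j) iota (c l) * e l).
  apply: (@subspace_sum _ _ iota (ord_ge Q _) _ _ (fun l => l != j)) => [|l lj].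
    exact: ord_ge_subspace.
  have [cl|cl] := eqVneq (c l) 0; first by rewrite cl rmorph0 mul0r; left.
  right; rewrite !ordZ //; have := jmin l cl.
  have : Q (e l) != Q (e j) by apply: contra_neq lj => /einj.
  by lia.
case/(ordD_lt Hj); rewrite -/(lincomb _ _ _) ordZ // /lincomb.
rewrite -(bigD1 (P := xpredT) j) //= => ? jE; split=> //; rewrite jE ?jmin //.
by exists j.
Qed.

Lemma ord_independent Q n (e : 'I_n -> F) :
  (forall i, e i != 0) -> injective (fun i => Q (e i)) -> independent iota e.
Proof.
move=> e0 einj c ce i; apply/eqP; apply: contraT => ci.
by have [] := ord_lincomb e0 einj ci; rewrite ce eqxx.
Qed.

Lemma ord_uniq_size Q U n (s : seq F) :
    has_qdim iota U [set 0] n -> {in s, forall z, z != 0 /\ U z} ->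
    uniq [seq Q z | z <- s] ->
  (size s <= n)%N.
Proof.
move=> Un sP suniq.
pose e (i : 'I_(size s)) := nth 0 s i.
have eP i : e i != 0 /\ U (e i) by apply: sP; rewrite mem_nth.
apply: (independent_le Un (v := e)); first by move=> i; case: (eP i).
apply: (@ord_independent Q) => [i|i j /= ij]; first by case: (eP i).
have lts (l : 'I_(size s)) : (l < size s)%N := ltn_ord l.
apply/val_inj/eqP; rewrite -(nth_uniq 0 _ _ suniq) ?size_map ?lts //.
by rewrite !(nth_map 0) ?lts //; apply/eqP.
Qed.

End Places.

(** * Riemann-Roch spaces *)

Section RiemannRoch.
Variables (k F : fieldType) (iota : {rmorphism k -> F}).
Implicit Types (Q : place iota) (u v z : F) (D E Z : {freeg (place iota) / int}).
Local Notation L := (@riemann_roch_space _ _ iota).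

Lemma coeff_point Q Q' n :
  coeff Q (<< Q' >> *+ n : {freeg (place iota) / int}) =
  if Q' == Q then n%:Z else 0.
Proof.
rewrite coeffMn coeffU mul1r; case: eqP => _; rewrite ?mul0rn //.
by rewrite -mulr_natr mul1r natz.
Qed.

Lemma rr_spaceP D z : L D z <-> forall Q, ord_ge Q (- coeff Q D) z.
Proof.
split=> [[->|zD] Q|zD]; first by left.
  by right; have := zD Q; lia.
have [->|/eqP z0] := eqVneq z 0; [by left | right => Q].
by have /(ord_geP _ _ (introN eqP z0)) := zD Q; lia.
Qed.

Lemma rr_subspace D : subspace iota (L D).
Proof.
split=> [|u v /rr_spaceP uD /rr_spaceP vD|c u /rr_spaceP uD]; first by left.
  by apply/rr_spaceP => Q; case: (ord_ge_subspace Q (- coeff Q D)) => _ + _; apply.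
by apply/rr_spaceP => Q; case: (ord_ge_subspace Q (- coeff Q D)) => _ _; apply.
Qed.

(** The weighted degree as the linear extension of [place_deg], from which additivity is immediate;
    the sum over the support in [div_deg] hides it. *)
Let wdeg D : int^o := fglift (fun Q => (place_deg Q)%:Z : int^o) D.

HB.instance Definition _ := GRing.isZmodMorphism.Build _ _ wdeg
  (lift_is_additive (fun Q => (place_deg Q)%:Z : int^o)).

Lemma div_degE D : div_deg D = wdeg D.
Proof.
rewrite -[in RHS](freeg_sumE D) raddf_sum /=; apply: eq_bigr => Q _.
by rewrite /wdeg liftU.
Qed.

Lemma div_degD D E : div_deg (D + E) = div_deg D + div_deg E.
Proof. by rewrite !div_degE raddfD. Qed.

Lemma div_degB D E : div_deg (D - E) = div_deg D - div_deg E.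
Proof. by rewrite !div_degE raddfB. Qed.

Lemma div_deg_point Q n :
  div_deg (<< Q >> *+ n : {freeg (place iota) / int}) = n%:Z * (place_deg Q)%:Z.
Proof.
by rewrite div_degE raddfMn /= /wdeg liftU scale1r -mulr_natl natz.
Qed.

Lemma qdimP (U W : set F) :
  (exists n, has_qdim iota U W n) -> has_qdim iota U W (qdim iota U W).
Proof. by move=> [n Un]; apply: xgetI Un. Qed.

(** A positive value cannot be the default 0, so it is a genuine dimension. *)
Lemma qdim_gt0 (U W : set F) :
  (0 < qdim iota U W)%N -> has_qdim iota U W (qdim iota U W).
Proof.
move=> q0; apply: qdimP; apply: contrapT => /forallNP noq.
by move: q0; rewrite /qdim xgetPN.
Qed.

Variables (gamma : nat) (P0 : place iota).
Hypothesis genusF : has_genus iota gamma.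
Hypothesis ratP0 : rational_point P0.

Lemma rr_dim_ge D : div_deg D + 1 <= gamma%:Z + (rr_dim D)%:Z.
Proof. by case: genusF => /(_ D) + _; lia. Qed.

(* In infinite dimension [rr_dim] is the junk value 0, and the genus bound
   fails for the larger divisor D + c P0 with c large. *)
Lemma rr_dimP D : has_qdim iota (L D) [set 0] (rr_dim D).
Proof.
pose E := D + << P0 >> *+ (`|div_deg D| + gamma)%N.
have /qdim_gt0 LE : (0 < rr_dim E)%N.
  have := rr_dim_ge E; rewrite div_degD div_deg_point ratP0.
  by lia.
apply: qdimP; have [|n Dn _] := has_qdim_sub (U := L D) (oner_neq0 F) _ LE.
  move=> u /rr_spaceP uD; apply/rr_spaceP => Q; rewrite mul1r.
  case: (uD Q) => [->|uQ]; [by left | right].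
  by rewrite coeffD coeff_point; case: ifP => _; lia.
by exists n.
Qed.

Lemma rr_dim_mul D E z :
  z != 0 -> (forall u, L D u -> L E (z * u)) -> (rr_dim D <= rr_dim E)%N.
Proof.
move=> z0 DE; have [n Dn] := has_qdim_sub z0 DE (rr_dimP E).
by rewrite (has_qdim_inj Dn (rr_dimP D)).
Qed.

Lemma rr_dim_neq0 D : (0 < rr_dim D)%N -> exists2 z, z != 0 & L D z.
Proof.
move=> D0; apply: contrapT => /forall2NP noz.
have LD0 u : L D u -> u = 0 by move=> Du; case: (noz u) => // /negP/negPn/eqP.
have /(has_qdim_inj (rr_dimP D)) : has_qdim iota (L D) [set 0] 0.
  exists (fun=> 0); split=> [[]//|u /LD0 ->|c _ []//].
  by exists (fun=> 0); rewrite /= lincomb0 ?subr0.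
by move: D0; rewrite lt0n => /eqP.
Qed.

Lemma rr_space_ord D z Q : z != 0 -> L D z -> - coeff Q D <= Q z.
Proof. by move=> z0 /rr_spaceP/(_ Q)/(ord_geP _ _ z0). Qed.

(* If the residue field of Q were infinite, the divisors gamma P0 - N Q would
   all have (junk) degree gamma, giving functions in L(gamma P0) of arbitrarily
   large order at Q. *)
Lemma place_deg_gt0 Q : (0 < place_deg Q)%N.
Proof.
rewrite lt0n; apply/eqP => Q0.
have P0Q : P0 == Q = false.
  by apply/eqP => P0Q; move: Q0; rewrite -P0Q ratP0.
pose G : {freeg (place iota) / int} := << P0 >> *+ gamma.
have high (N : nat) : exists2 z, z != 0 & L G z /\ N%:Z <= Q z.
  pose D := G - << Q >> *+ N.
  have /rr_dim_neq0[z z0 Dz] : (0 < rr_dim D)%N.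
    have := rr_dim_ge D; rewrite div_degB !div_deg_point ratP0 Q0.
    by lia.
  exists z => //; split; last first.
    by have := rr_space_ord Q z0 Dz; rewrite coeffB !coeff_point P0Q eqxx; lia.
  apply/rr_spaceP => Q'; right; have := rr_space_ord Q' z0 Dz.
  by rewrite coeffB !coeff_point; case: ifP => _; case: ifP => _; lia.
have long n : exists s : seq F, [/\ size s = n,
    {in s, forall z, z != 0 /\ L G z} & uniq [seq Q z | z <- s]].
  elim: n => [|n [s [sn sP suniq]]]; first by exists [::].
  (* An order exceeding the sum of the absolute values of all earlier orders is new. *)
  have [z z0 [Gz zN]] := high (\sum_(y <- s) `|Q y|).+1%N.
  exists (z :: s); split; first by rewrite /= sn.
    by move=> y; rewrite inE => /predU1P[->//|/sP].
  rewrite /= suniq andbT; apply/mapP => -[y ys zy].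
  have : (`|Q y| <= \sum_(y <- s) `|Q y|)%N by rewrite (big_rem y) //= leq_addr.
  by lia.
have [s [sn sP suniq]] := long (rr_dim G).+1.
by have := ord_uniq_size (rr_dimP G) sP suniq; rewrite sn ltnn.
Qed.

(** Multiplication by t^(c+1), with t a uniformiser at Q and c the coefficient of D at Q, sends L(D
    + Q) into the local ring, and the functions landing in the maximal ideal lie in L(D). The
    quotient is the residue field. *)
Lemma rr_dimDpoint D Q : (rr_dim (D + << Q >>)%R <= rr_dim D + place_deg Q)%N.
Proof.
have [t t1] := place_ord_norm Q.
have t0 : t != 0 by apply/eqP => t0; move: t1; rewrite t0 place_ord0.
have tn0 n : t ^ n != 0 by rewrite expfz_neq0.
have cQ Q' : coeff Q' (D + << Q >>) = coeff Q' D + (Q == Q')%:Z.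
  by rewrite coeffD coeffU mul1r natz.
have := has_qdim_quot (z := t ^ (coeff Q D + 1)) (rr_subspace _)
  (ord_ge_subspace Q 1) (rr_dimP (D + << Q >>)) (qdim_gt0 (place_deg_gt0 Q))
  (rr_dimP D).
apply=> u /rr_spaceP Du.
  have [->|u0] := eqVneq u 0; first by left; rewrite mulr0.
  right; have /(ord_geP _ _ u0) := Du Q; rewrite cQ eqxx.
  by rewrite place_ordM // ord_exprz // t1; lia.
have [->|u0 uQ] := eqVneq u 0; first by left.
apply/rr_spaceP => Q'; right; have [<-|QQ'] := eqVneq Q Q'.
  move/ord_geP: uQ; rewrite mulf_neq0 // place_ordM // ord_exprz // t1 => /(_ isT).
  by lia.
by have /(ord_geP _ _ u0) := Du Q'; rewrite cQ (negbTE QQ'); lia.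
Qed.

Lemma rr_dimDpoints D Q n :
  (rr_dim (D + << Q >> *+ n)%R <= rr_dim D + n * place_deg Q)%N.
Proof.
elim: n => [|n IHn]; first by rewrite mulr0n addr0 addn0.
rewrite mulrSr addrA; apply: leq_trans (rr_dimDpoint _ _) _.
by rewrite mulSnr addnA leq_add2r.
Qed.

(** E is reached from D by adding points, each raising l by at most its degree. *)
Lemma rr_dim_le_deg D E : (forall Q, coeff Q D <= coeff Q E) ->
  (rr_dim E)%:Z <= (rr_dim D)%:Z + div_deg E - div_deg D.
Proof.
move=> DE; pose n Q := absz (coeff Q (E - D)).
have nE Q : (n Q)%:Z = coeff Q (E - D).
  by rewrite /n coeffB; have := DE Q; lia.
pose S (r : seq (place iota)) : {freeg (place iota) / int} :=
  \sum_(Q <- r) << Q >> *+ n Q.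
have -> : E = D + S (dom (E - D)).
  rewrite -[LHS](subrK D) addrC -[in LHS](freeg_sumE (E - D)); congr (_ + _).
  by apply: eq_bigr => Q _; rewrite freegU_muln -nE natz.
have step D1 Q : (rr_dim D1)%:Z <= (rr_dim D)%:Z + div_deg D1 - div_deg D ->
    (rr_dim (D1 + << Q >> *+ n Q))%:Z <=
    (rr_dim D)%:Z + div_deg (D1 + << Q >> *+ n Q) - div_deg D.
  by rewrite div_degD div_deg_point; have := rr_dimDpoints D1 Q (n Q); lia.
elim: (dom _) => [|Q r IHr]; rewrite /S ?big_nil ?addr0; first by lia.
by rewrite big_cons addrCA addrC; apply: step.
Qed.

(** Take D attaining the genus bound. Multiplication by z embeds L(D + Z) in L(D), so deg Z > 0
    would make D + Z violate the bound. *)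
Lemma div_deg_le0 Z z : z != 0 -> (forall Q, coeff Q Z <= Q z) -> div_deg Z <= 0.
Proof.
move=> z0 Zz; have [_ [D Dg]] := genusF.
have : (rr_dim (D + Z)%R <= rr_dim D)%N.
  apply: (rr_dim_mul z0) => u /rr_spaceP uDZ.
  have [->|u0] := eqVneq u 0; first by left; rewrite mulr0.
  apply/rr_spaceP => Q; right; rewrite place_ordM //.
  have := Zz Q; have /(ord_geP _ _ u0) := uDZ Q; rewrite coeffD; lia.
by have := rr_dim_ge (D + Z); rewrite div_degD; lia.
Qed.

(* Among the finite divisors between B and (z) one of maximal degree is (z):
   the degrees are bounded by [div_deg_le0], and adding a point raises them. *)
Lemma principal_divisor B z : z != 0 -> (forall Q, coeff Q B <= Q z) ->
  exists Z, forall Q, coeff Q Z = Q z.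
Proof.
move=> z0 Bz.
pose A N := `[< exists Z, (forall Q, coeff Q Z <= Q z) /\
                          div_deg Z = div_deg B + Posz N >].
have A0 : exists N, A N.
  by exists 0%N; apply/asboolP; exists B; rewrite addr0.
have AN N : A N -> (N <= `|div_deg B|)%N.
  by move=> /asboolP[Z [/(div_deg_le0 z0) + ZN]]; rewrite ZN; lia.
have [N /asboolP[Z [Zz ZN]] Nmax] := ex_maxnP A0 AN.
exists Z => Q; apply/eqP; rewrite eq_le Zz leNgt; apply/negP => ltQ.
have /Nmax : A (N + place_deg Q)%N; last by have := place_deg_gt0 Q; lia.
apply/asboolP; exists (Z + << Q >>); split => [Q'|].
  rewrite coeffD coeffU mul1r natz; have [<-|_] := eqVneq Q Q'; first by lia.
  by have := Zz Q'; lia.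
by rewrite div_degD ZN -[<< Q >>]mulr1n div_deg_point; lia.
Qed.

(** Sharpness passes from a divisor D attaining the bound to n P0: for large n some z in L(n P0 - D)
    is nonzero, and with Z = (z) one has D - Z <= n P0, deg Z <= 0 and l(D - Z) <= l(D). Then
    [rr_dim_le_deg] bounds l(n P0). *)
Lemma rr_dim_point_large : exists n0 : nat, forall n : nat, (n0 <= n)%N ->
  (rr_dim (<< P0 >> *+ n)%R + gamma <= n.+1)%N.
Proof.
have [_ [D Dg]] := genusF; exists (`|div_deg D| + gamma)%N => n nD.
have /rr_dim_neq0[z z0 nDz] : (0 < rr_dim (<< P0 >> *+ n - D)%R)%N.
  have := rr_dim_ge (<< P0 >> *+ n - D).
  by rewrite div_degB div_deg_point ratP0; lia.
have zQ Q : coeff Q (D - << P0 >> *+ n) <= Q z.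
  by have := rr_space_ord Q z0 nDz; rewrite !coeffB !coeff_point; lia.
have [Z ZE] := principal_divisor z0 zQ.
have Z0 : div_deg Z <= 0 by apply: (@div_deg_le0 _ z) => // Q; rewrite ZE.
have DZ : (rr_dim (D - Z)%R <= rr_dim D)%N.
  apply: (@rr_dim_mul _ _ z^-1); first by rewrite invr_eq0.
  move=> u uDZ; have [->|u0] := eqVneq u 0; first by left; rewrite mulr0.
  apply/rr_spaceP => Q; right; rewrite place_ordM ?invr_eq0 // ordV //.
  by have := rr_space_ord Q u0 uDZ; rewrite coeffB ZE; lia.
have DZP Q : coeff Q (D - Z) <= coeff Q (<< P0 >> *+ n).
  by have := zQ Q; rewrite !coeffB !coeff_point ZE; lia.
have := @rr_dim_le_deg (D - Z) (<< P0 >> *+ n) DZP.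
by rewrite div_degB div_deg_point ratP0; lia.
Qed.

End RiemannRoch.


(** * Functions regular outside one point *)

(** Pairing i with b - i: as b does not divide a i for 0 < i < b, the two floors add up to a - 1.
    The sum is the number of gaps of the semigroup generated by a and b. *)
Lemma sum_div_mul a b : (0 < a)%N -> (0 < b)%N -> coprime a b ->
  ((\sum_(0 <= i < b) (a * i) %/ b).*2 = a.-1 * b.-1)%N.
Proof.
move=> a0 b0 ab; rewrite big_ltn // muln0 div0n add0n -addnn.
rewrite [in X in (X + _)%N]big_nat_rev -big_split /=.
rewrite (eq_big_nat _ _ (F2 := fun=> a.-1)) => [|i /andP[i0 ib]].
  by rewrite sum_nat_const_nat subn1 mulnC.
have nd : ~~ (b %| a * i)%N.
  rewrite Gauss_dvdr; last by rewrite coprime_sym.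
  by apply/negP => /dvdn_leq; lia.
have r0 : (0 < (a * i) %% b)%N by rewrite lt0n.
have rb := ltn_pmod (a * i) b0.
move: (divn_eq (a * i) b) r0 rb; set q := (_ %/ b)%N; set r := (_ %% b)%N => E r0 rb.
have qa : (q < a)%N by rewrite -(ltn_pmul2r b0); move: E ib a0; nia.
rewrite (_ : a * (1 + b - i.+1) = (a.-1 - q) * b + (b - r))%N.
  rewrite divnMDl // [((b - r) %/ b)%N]divn_small ?addn0; last by lia.
  by rewrite subnK; lia.
by move: E rb qa; rewrite mulnBr mulnBl; nia.
Qed.

Section OnePoint.
Variables (k F : fieldType) (iota : {rmorphism k -> F}) (gamma a b : nat).
Variables (P0 : place iota) (u v : F).
Hypotheses (genusF : has_genus iota gamma) (ratP0 : rational_point P0).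
Hypotheses (a0 : (0 < a)%N) (b0 : (0 < b)%N) (ab : coprime a b).
Hypothesis gammaE : (gamma.*2 = a.-1 * b.-1)%N.
Hypotheses (u0 : u != 0) (v0 : v != 0).
Hypotheses (P0u : P0 u = - a%:Z) (P0v : P0 v = - b%:Z).
Hypothesis Qu : forall Q : place iota, Q != P0 -> 0 <= Q u.
Hypothesis Qv : forall Q : place iota, Q != P0 -> 0 <= Q v.

Let mon (t : nat * nat) : F := u ^+ t.1 * v ^+ t.2.

Let mon_neq0 t : mon t != 0.
Proof. by rewrite mulf_neq0 ?expf_neq0. Qed.

Let ord_mon (Q : place iota) t : Q (mon t) = t.1%:Z * Q u + t.2%:Z * Q v.
Proof. by rewrite place_ordM ?expf_neq0 // !ord_exp. Qed.

(** The pole order a i + b e determines i modulo b, as a is invertible modulo b; then i < b gives i,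
    hence e. *)
Let P0_mon_inj t t' : (t.1 < b)%N -> (t'.1 < b)%N ->
  P0 (mon t) = P0 (mon t') -> t = t'.
Proof.
case: t t' => [i e] [i' e'] /= ib ib'.
rewrite !ord_mon /= P0u P0v => H.
have H' : (a * i + b * e = a * i' + b * e')%N by lia.
have ii' : i = i'.
  have : (a * i = a * i' %[mod b])%N.
    have := congr1 (modn^~ b) H'.
    by rewrite /= ![(_ + b * _)%N]addnC ![(b * _)%N]mulnC !modnMDl.
  move/eqP; wlog le : i i' e e' ib ib' H H' / (i' <= i)%N.
    move=> W E; case/orP: (leq_total i' i) => le.
      exact: (W _ _ _ _ ib ib' H H' le E).
    by rewrite eq_sym in E; apply/esym/(W _ _ _ _ ib' ib (esym H) (esym H') le E).
  rewrite eqn_mod_dvd ?leq_mul2l ?le ?orbT // -mulnBr Gauss_dvdr; last first.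
    by rewrite coprime_sym.
  by have [|/dvdn_leq /[apply]] := posnP (i - i'); lia.
by congr (_, _); [|move: H'; rewrite ii' => /addnI /eqP; rewrite eqn_mul2l; lia].
Qed.

(* The monomials with pole order at most n number n + 1 - gamma by
   [sum_div_mul], hence fill L(n P0). *)
Lemma regular_span z : z != 0 -> (forall Q : place iota, Q != P0 -> 0 <= Q z) ->
  exists N (s : 'I_N -> nat * nat) c, [/\ forall i, ((s i).1 < b)%N,
    injective s & z = lincomb iota c (fun i => mon (s i))].
Proof.
move=> z0 Qz; have [n0 n0P] := rr_dim_point_large genusF ratP0.
(* [N] exceeds both the threshold of [rr_dim_point_large] and the pole order of z. The shape of [n]
   makes a i + b e <= n equivalent to e <= floor(a (b - 1 - i) / b) + N, so that [w i] counts the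
   admissible e. *)
pose N := (n0 + `|P0 z|)%N; pose n := (a * b.-1 + b * N)%N.
have Nn : (N <= n)%N by rewrite (leq_trans (leq_pmull N b0)) ?leq_addl.
pose w i := (a * (b.-1 - i) %/ b + N).+1.
pose s := [seq (i, e) | i <- seq.iota 0 b, e <- seq.iota 0 (w i)].
have sP t : t \in s -> (t.1 < b)%N /\ (a * t.1 + b * t.2 <= n)%N.
  case/allpairsPdep => i [e [+ + ->]] /=; rewrite !mem_iota /= add0n /w ltnS => ib ew.
  split=> //.
  have := leq_trunc_div (a * (b.-1 - i)) b; rewrite /n.
  have : (a * i + a * (b.-1 - i) = a * b.-1)%N by rewrite -mulnDr subnKC //; lia.
  have : (b * e <= b * ((a * (b.-1 - i)) %/ b + N))%N by rewrite leq_mul2l ew orbT.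
  by rewrite mulnDr [(b * (_ %/ _))%N]mulnC; lia.
have suniq : uniq s.
  by apply: allpairs_uniq_dep => [|i _|[i e] [i' e'] _ _ [-> ->]]; rewrite ?iota_uniq.
have ssize : (size s + gamma = n.+1)%N.
  have -> : size s = (\sum_(0 <= i < b) (a * i) %/ b + b * N.+1)%N.
    have -> : (b * N.+1 = \sum_(0 <= i < b) N.+1)%N by rewrite sum_nat_const_nat subn0.
    rewrite big_nat_rev -big_split /= size_allpairs_dep sumnE big_map.
    rewrite -[X in seq.iota _ X]subn0 -/(index_iota 0 b).
    apply: eq_big_nat => i ib; rewrite size_iota /w addnS.
    by rewrite (_ : (0 + b - i.+1 = b.-1 - i)%N) //; lia.
  have := sum_div_mul a0 b0 ab; rewrite -gammaE => /double_inj ->.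
  by rewrite /n; move: gammaE; rewrite -addnn; nia.
pose e (i : 'I_(size s)) := mon (nth (0, 0)%N s i).
have eP (i : 'I_(size s)) := sP _ (mem_nth (0, 0)%N (ltn_ord i)).
have sinj : injective (fun i : 'I_(size s) => nth (0, 0)%N s i).
  move=> i j /eqP; rewrite nth_uniq // => /eqP; exact: val_inj.
have Le i : riemann_roch_space (<< P0 >> *+ n) (e i).
  right=> Q; rewrite coeff_point ord_mon; have [_] := eP i.
  have [<-|QP0] := eqVneq P0 Q; last first.
    by rewrite eq_sym in QP0; rewrite addr0 addr_ge0 ?mulr_ge0 ?Qu ?Qv.
  rewrite P0u P0v -lez_nat PoszD !PoszM.
  by rewrite !mulrN -opprD [- _ + _]addrC subr_ge0 ![a%:Z * _]mulrC ![b%:Z * _]mulrC.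
have inde : independent iota e.
  apply: (@ord_independent _ _ _ P0) => [i|i j /= eij]; first exact: mon_neq0.
  by apply: sinj; apply: P0_mon_inj eij; [case: (eP i) | case: (eP j)].
have Ln := rr_dimP genusF ratP0 (<< P0 >> *+ n).
have rrE : rr_dim (<< P0 >> *+ n) = size s.
  have := independent_le Ln Le inde; have := n0P n.
  by move: ssize Nn; rewrite /N; move: (n); lia.
rewrite rrE in Ln.
have [|c zc] := independent_basis Ln Le inde (u := z).
  right=> Q; rewrite coeff_point; have [<-|QP0] := eqVneq P0 Q.
    by move: Nn; rewrite /N; move: (n); lia.
  by rewrite eq_sym in QP0; rewrite addr0 Qz.
by exists (size s), (fun i => nth (0, 0)%N s i), c; split=> // i; case: (eP i).
Qed.

(** The order of z at [P0] is that of a monomial u^i v^e, so a i + b e = a (b - 1) - b s. Then b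
    divides a (b - 1 - i), which forces i = b - 1 and s = - e. *)
Lemma regular_ord_pole z (s : int) :
    z != 0 -> (forall Q : place iota, Q != P0 -> 0 <= Q z) ->
    P0 z = b%:Z * s - a%:Z * b.-1%:Z -> s <= 0.
Proof.
move=> z0 Qz; have [N [t [c [tb tinj zE]]]] := regular_span z0 Qz.
have e0 i : mon (t i) != 0 := mon_neq0 (t i).
have einj : injective (fun i => P0 (mon (t i))).
  by move=> i j /= /P0_mon_inj-/(_ (tb i) (tb j))/tinj.
have [[i ci]|] := pselect (exists i, c i != 0); last first.
  move=> /forallNP c0; rewrite zE lincomb0 ?eqxx // in z0.
  by move=> i; apply/eqP; apply: contraT => /c0.
have [_ _ [j _ zj]] := ord_lincomb e0 einj ci.
rewrite zE zj ord_mon P0u P0v => H; rewrite leNgt; apply/negP => s0.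
have H' : (a * (b.-1 - (t j).1) = b * (`|s| + (t j).2))%N by have := tb j; nia.
have : (b %| a * (b.-1 - (t j).1))%N by rewrite H' dvdn_mulr.
rewrite Gauss_dvdr; last by rewrite coprime_sym.
have [b1|bt] := posnP (b.-1 - (t j).1); last by move/dvdn_leq=> /(_ bt); lia.
by move: H'; rewrite b1 muln0; nia.
Qed.

Variable Q0 : place iota.
Hypotheses (Q0u : Q0 u = 1) (Q0v : Q0 v = b%:Z).

Let Q0_mon_inj t t' : (t.1 < b)%N -> (t'.1 < b)%N ->
  Q0 (mon t) = Q0 (mon t') -> t = t'.
Proof.
case: t t' => [i e] [i' e'] /= ib ib'.
rewrite !ord_mon /= Q0u Q0v => H.
have H' : (i + e * b = i' + e' * b)%N by lia.
have ii' : i = i'.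
  have := congr1 (modn^~ b) H'; rewrite /= ![(_ + _ * b)%N]addnC !modnMDl.
  by rewrite !modn_small.
by congr (_, _); [|move: H'; rewrite ii' => /addnI /eqP; rewrite eqn_mul2r; lia].
Qed.

(** The orders i + b e of the monomials at [Q0] are distinct as well, so order b - 1 there means
    that u^(b-1) occurs in z. Distinctness at [P0] then makes the pole of z there at least that of
    u^(b-1). *)
Lemma regular_ord_zero z :
    z != 0 -> (forall Q : place iota, Q != P0 -> 0 <= Q z) ->
  Q0 z = b.-1%:Z -> P0 z <= - (a%:Z * b.-1%:Z).
Proof.
move=> z0 Qz; have [N [t [c [tb tinj zE]]]] := regular_span z0 Qz.
have e0 i : mon (t i) != 0 := mon_neq0 (t i).
have einj : injective (fun i => P0 (mon (t i))).
  by move=> i j /= /P0_mon_inj-/(_ (tb i) (tb j))/tinj.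
have einj' : injective (fun i => Q0 (mon (t i))).
  by move=> i j /= /Q0_mon_inj-/(_ (tb i) (tb j))/tinj.
have [[i ci]|] := pselect (exists i, c i != 0); last first.
  move=> /forallNP c0; rewrite zE lincomb0 ?eqxx // in z0.
  by move=> i; apply/eqP; apply: contraT => /c0.
have [_ _ [j cj zj]] := ord_lincomb e0 einj' ci.
have [_ + _] := ord_lincomb e0 einj cj.
rewrite zE zj !ord_mon P0u P0v Q0u Q0v => H H'.
have tj : (t j).2 = 0%N by have := tb j; nia.
have ti : Posz (t j).1 = b.-1 by move: H'; rewrite tj; lia.
by move: H; rewrite tj ti mul0r addr0 mulrN [_ * Posz a]mulrC.
Qed.

End OnePoint.

(** * Gaps at several points *)

(* Two of the #|k| + 1 points of the projective line spanned by h and h' lying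
   in the same W i would put both h and h' in W i. *)
Lemma avoid_subspaces (k : finFieldType) (F : fieldType) (iota : {rmorphism k -> F})
    (I : eqType) (V : set F) (W : I -> set F) (r : seq I) :
    subspace iota V -> (forall i, subspace iota (W i)) -> (size r <= #|k|)%N ->
    (forall i, i \in r -> exists2 h, V h & ~ W i h) ->
  exists2 h, V h & forall i, i \in r -> ~ W i h.
Proof.
move=> [V0 VD VZ] Wsub; elim: r => [|i r IHr] rk rP; first by exists 0.
have [|j jr|h Vh hP] := IHr; [exact: ltnW | by apply: rP; rewrite inE jr orbT |].
have [h' Vh' h'P] := rP i (mem_head _ _).
(* [option k] indexes the projective line through h and h', with [None] as the point at infinity. *)
pose w (c : option k) := if c is Some c then h + iota c * h' else h'.
have [[c wc]|] := pselect (exists c, forall j, j \in i :: r -> ~ W j (w c)).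
  by exists (w c) => //; case: c {wc} => //= c; apply: VD => //; apply: VZ.
move=> /forallNP bad.
have {}bad c : exists j, j \in i :: r /\ W j (w c).
  apply: contrapT => noj; apply: (bad c) => j jr Wj.
  by apply: noj; exists j.
have [f fP] := choice bad.
have finj : injective f.
  move=> c c' cc'; apply/eqP; apply: contraT => cnc'; exfalso.
  have [fr Wc] := fP c; have [_ Wc'] := fP c'; rewrite -cc' in Wc'.
  have Wh d : W (f c) h' -> W (f c) (w (Some d)) -> W (f c) h.
    move=> Wh' Wd; have [_ _ WZ] := Wsub (f c).
    by have := subspaceB (Wsub (f c)) Wd (WZ d _ Wh'); rewrite /= addrK.
  have [Wfh Wfh'] : W (f c) h /\ W (f c) h'.
    case: c c' cnc' Wc Wc' {cc' fr} Wh => [c|] [c'|] //= cnc' Wc Wc' Wh.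
    - suff Wh' : W (f (Some c)) h' by split=> //; apply: Wh Wc.
      apply: (@subspaceZI _ _ _ _ (c - c')) (Wsub _) _ _.
        by rewrite subr_eq0; apply: contra_neq cnc' => ->.
      have := subspaceB (Wsub _) Wc Wc'.
      by rewrite opprD addrACA subrr add0r rmorphB mulrBl.
    - by split=> //; apply: Wh Wc.
    - by split=> //; apply: Wh Wc'.
  by move: fr; rewrite inE => /predU1P[fi|/hP//]; rewrite fi in Wfh'.
have : (size [seq f c | c : option k] <= size (i :: r))%N.
  apply: uniq_leq_size; first by rewrite map_inj_uniq ?enum_uniq.
  by move=> j /mapP[c _ ->]; case: (fP c).
by rewrite size_image card_option ltnNge rk.
Qed.

Section Gaps.
Variables (k F : fieldType) (iota : {rmorphism k -> F}).
Variables (m : nat) (p : 'I_m -> place iota).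
Hypothesis pinj : injective p.
Implicit Types alpha : {ffun 'I_m -> nat}.

Definition divisor_of alpha : {freeg (place iota) / int} :=
  \sum_(i < m) << p i >> *+ alpha i.

(** Equivalently, L(A - P_l) is strictly smaller than L(A), where A is [divisor_of alpha]. *)
Definition attained alpha l : Prop :=
  exists h, [/\ h != 0, riemann_roch_space (divisor_of alpha) h
              & p l h = - (alpha l)%:Z].

Lemma coeff_divisor_of alpha l : coeff (p l) (divisor_of alpha) = (alpha l)%:Z.
Proof.
rewrite raddf_sum /= (bigD1 l) //= coeff_point eqxx big1 ?addr0 // => i il.
by rewrite coeff_point (inj_eq pinj) (negbTE il).
Qed.

Lemma coeff_divisor_of_out alpha Q :
  (forall l, p l != Q) -> coeff Q (divisor_of alpha) = 0.
Proof.
move=> pQ; rewrite raddf_sum /= big1 // => i _.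
by rewrite coeff_point (negbTE (pQ i)).
Qed.

Lemma coeff_divisor_of_ge0 alpha Q : 0 <= coeff Q (divisor_of alpha).
Proof.
rewrite raddf_sum /=; apply: sumr_ge0 => i _.
by rewrite coeff_point; case: ifP.
Qed.

End Gaps.

(** If every order is attained, the functions of L(A) with too small a pole at a given point form a
    proper subspace of L(A); with at least m constants, [avoid_subspaces] finds one function outside
    all m of them. *)
Lemma weierstrass_semigroupP (k : finFieldType) (F : fieldType)
    (iota : {rmorphism k -> F}) m (p : 'I_m -> place iota) (o : 'I_m)
    (alpha : {ffun 'I_m -> nat}) :
    injective p -> (m <= #|k|)%N ->
  weierstrass_semigroup p alpha <-> forall l, attained p alpha l.
Proof.
move=> pinj mk; split=> [[h h0 hP] l|att].
  (* When [alpha l] is 0 the function h may vanish at [p l], so the constant 1 replaces it. *)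
  have [al0|al] := posnP (alpha l).
    exists 1; rewrite oner_eq0 al0 ord1; split=> //; right=> Q.
    by rewrite ord1 add0r coeff_divisor_of_ge0.
  exists h; split=> //; last by have := hP (p l); rewrite coeff_divisor_of //; lia.
  by right=> Q; rewrite -(hP Q); lia.
pose V := riemann_roch_space (divisor_of p alpha).
pose W l := ord_ge (p l) (1 - (alpha l)%:Z).
have [|i||l _|h Vh hW] := @avoid_subspaces k F iota _ V W (enum 'I_m).
- exact: rr_subspace.
- exact: ord_ge_subspace.
- by rewrite size_enum_ord.
- have [h [h0 Vh hl]] := att l; exists h => //.
  by move/(ord_geP _ _ h0); rewrite hl; lia.
have {}hW l : ~ W l h by apply: hW; rewrite mem_enum.
(* The index [o] provides at least one avoided subspace, and 0 lies in each of them. *)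
have h0 : h != 0 by apply/eqP => h0; apply: (hW o); rewrite h0; left.
exists h => // Q; have := rr_space_ord Q h0 Vh.
have [[l <-]|/forallNP pQ] := pselect (exists l, p l = Q).
  have /(ord_geP _ _ h0) := hW l.
  by rewrite coeff_divisor_of //; lia.
by rewrite coeff_divisor_of_out => [|l]; [lia | apply/eqP].
Qed.

(** * Monomials in u and the v_t, and the orders they attain *)

Section Monomials.
Variables (k F : fieldType) (iota : {rmorphism k -> F}) (gamma a b m : nat).
Variables (o : 'I_m) (p : 'I_m -> place iota) (u : F) (v : 'I_m -> F).
Implicit Types (Q : place iota) (t l : 'I_m).
Hypotheses (genusF : has_genus iota gamma) (rato : rational_point (p o)).
Hypotheses (pinj : injective p) (m2 : (2 <= m)%N).
Hypotheses (a0 : (0 < a)%N) (b0 : (0 < b)%N) (ab : coprime a b).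
Hypothesis gammaE : (gamma.*2 = a.-1 * b.-1)%N.
Hypotheses (u0 : u != 0) (v0 : forall t, v t != 0).
Hypotheses (ou : p o u = - a%:Z) (pu : forall t, t != o -> p t u = 1).
Hypothesis Qu : forall Q : place iota, Q != p o -> 0 <= Q u <= 1.
Hypothesis Qv : forall t, t != o -> forall Q : place iota,
  Q (v t) = b%:Z * (p t == Q)%:Z - b%:Z * (p o == Q)%:Z.

Local Notation attained := (attained p).

Let ov t : t != o -> p o (v t) = - b%:Z.
Proof. by move=> to; rewrite Qv // eqxx (inj_eq pinj) (negbTE to); lia. Qed.

Let pv t : t != o -> p t (v t) = b%:Z.
Proof.
by move=> to; rewrite Qv // eqxx (inj_eq pinj) [o == t]eq_sym (negbTE to); lia.
Qed.

Let Qv_ge0 t : t != o -> forall Q : place iota, Q != p o -> 0 <= Q (v t).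
Proof. by move=> to Q Qo; rewrite Qv // [p o == Q]eq_sym (negbTE Qo); lia. Qed.

Let other_exists : exists t, t != o.
Proof.
have : (1 < #|'I_m|)%N by rewrite card_ord.
case/card_gt1P => s [t [_ _ st]]; have [<-|so] := eqVneq s o.
  by exists t; rewrite eq_sym.
by exists s.
Qed.

Definition monomial (r : nat) (e : 'I_m -> int) : F :=
  u ^+ r * \prod_(t < m | t != o) v t ^ e t.

Lemma monomial_neq0 r e : monomial r e != 0.
Proof.
rewrite mulf_neq0 ?expf_neq0 //; apply/prodf_neq0 => t _.
by rewrite expfz_neq0.
Qed.

Lemma ord_monomial Q r e :
  Q (monomial r e) = r%:Z * Q u + \sum_(t < m | t != o) e t * Q (v t).
Proof.
have [n0 E] := @ord_prod _ _ iota Q _ (index_enum 'I_m) (fun t => t != o)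
  (fun t => v t ^ e t) (fun t => expfz_neq0 _ (v0 t)).
rewrite place_ordM ?expf_neq0 // ord_exp // E; congr (_ + _).
by apply: eq_bigr => t _; rewrite ord_exprz.
Qed.

Lemma ord_monomial_first r e :
  p o (monomial r e) = - (a%:Z * r%:Z + b%:Z * \sum_(t < m | t != o) e t).
Proof.
rewrite ord_monomial ou (eq_bigr (fun t => - b%:Z * e t)) => [|t to].
  by rewrite -mulr_sumr mulrN mulNr -opprD [r%:Z * _]mulrC.
by rewrite ov // mulrC.
Qed.

Lemma ord_monomial_other r e l : l != o ->
  p l (monomial r e) = r%:Z + b%:Z * e l.
Proof.
move=> lo; rewrite ord_monomial pu // mulr1 (bigD1 l) //= pv // big1.
  by rewrite addr0 mulrC.
move=> t /andP[to tl]; rewrite Qv // !(inj_eq pinj) (negbTE tl).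
by rewrite [o == l]eq_sym (negbTE lo) !mulr0.
Qed.

Lemma ord_monomial_out r e Q : (forall l, p l != Q) ->
  Q (monomial r e) = r%:Z * Q u.
Proof.
move=> pQ; rewrite ord_monomial big1 ?addr0 // => t to.
by rewrite Qv // !(negbTE (pQ _)) !mulr0.
Qed.

Lemma rr_monomial (alpha : {ffun 'I_m -> nat}) r e :
    (forall t, t != o -> - (alpha t)%:Z <= r%:Z + b%:Z * e t) ->
    a%:Z * r%:Z + b%:Z * \sum_(t < m | t != o) e t <= (alpha o)%:Z ->
  riemann_roch_space (divisor_of p alpha) (monomial r e).
Proof.
move=> He Ho; right=> Q.
have [[l <-]|/forallNP pQ] := pselect (exists l, p l = Q).
  rewrite coeff_divisor_of //; have [->|lo] := eqVneq l o.
    by rewrite ord_monomial_first addrC subr_ge0.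
  by rewrite ord_monomial_other // -lerBlDr sub0r He.
have {}pQ l : p l != Q by apply/eqP.
rewrite coeff_divisor_of_out // ord_monomial_out // addr0 mulr_ge0 //.
by have /andP[] := Qu (Q := Q) ltac:(by rewrite eq_sym).
Qed.

Section Reduced.
Variables (alpha : {ffun 'I_m -> nat}) (r : nat) (e : 'I_m -> int).
Hypothesis rb : (r < b)%N.
(** So [e t] is the least exponent for which the monomial keeps to the pole bound [alpha t] at
    [p t]. *)
Hypothesis eP : forall t, t != o ->
  - (alpha t)%:Z <= r%:Z + b%:Z * e t <= - (alpha t)%:Z + b%:Z - 1.

(* Dividing by the monomial leaves poles of order less than b at the p t,
   which u ^ (b - 1) cancels. *)
Let z h := h / monomial r e * u ^+ b.-1.

Let z_neq0 h : h != 0 -> z h != 0.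
Proof. by move=> h0; rewrite !mulf_neq0 ?invr_eq0 ?monomial_neq0 ?expf_neq0. Qed.

Let ord_z Q h : h != 0 -> Q (z h) = Q h - Q (monomial r e) + b.-1%:Z * Q u.
Proof.
move=> h0; have n0 := monomial_neq0 r e.
rewrite /z place_ordM ?mulf_neq0 ?invr_eq0 ?expf_neq0 //.
by rewrite place_ordM ?invr_eq0 // ordV // ord_exp.
Qed.

Let z_regular h : h != 0 -> riemann_roch_space (divisor_of p alpha) h ->
  forall Q : place iota, Q != p o -> 0 <= Q (z h).
Proof.
move=> h0 Lh Q Qo; rewrite ord_z //; have := rr_space_ord Q h0 Lh.
have [[l lQ]|/forallNP pQ] := pselect (exists l, p l = Q).
  have lo : l != o by apply: contra_neq Qo => <-.
  rewrite -lQ coeff_divisor_of // ord_monomial_other // pu // mulr1.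
  by have := eP lo; lia.
have {}pQ l : p l != Q by apply/eqP.
rewrite coeff_divisor_of_out // ord_monomial_out //.
have /andP[Qu0 _] := Qu Qo; rewrite oppr0 -addrA -mulNr -mulrDl => Qh.
by rewrite addr_ge0 // mulr_ge0 //; lia.
Qed.

(** Here r matches the residue of [alpha o] and s is the pole order, in multiples of b, that the
    monomial lacks at [p o]. If h attains [alpha o], then [z h] has pole order a (b - 1) + b s
    there, and [regular_ord_pole] gives s >= 0. *)
Lemma attained_first (s : int) :
    (alpha o)%:Z = a%:Z * r%:Z + b%:Z * (\sum_(t < m | t != o) e t + s) ->
  attained alpha o <-> 0 <= s.
Proof.
move=> Es; have [t0 t0o] := other_exists; split=> [[h [h0 Lh ho]]|s0].
  have zo : p o (z h) = b%:Z * - s - a%:Z * b.-1%:Z.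
    by rewrite ord_z // ord_monomial_first ho ou Es; lia.
  have := regular_ord_pole genusF rato a0 b0 ab gammaE u0 (v0 t0) ou (ov t0o)
    (fun Q Qo => proj1 (andP (Qu Qo))) (Qv_ge0 t0o) (z_neq0 h0)
    (z_regular h0 Lh) zo.
  by lia.
(* Raising one exponent by s supplies the missing pole at [p o] and only increases the order at
   [p t0]. *)
pose e' t := e t + (t == t0)%:Z * s.
have e'E : \sum_(t < m | t != o) e' t = \sum_(t < m | t != o) e t + s.
  rewrite big_split /=; congr (_ + _).
  rewrite (bigD1 t0) //= eqxx mul1r big1 ?addr0 // => t /andP[_ /negbTE->].
  by rewrite mul0r.
exists (monomial r e'); split; first exact: monomial_neq0.
  apply: rr_monomial => [t /eP|]; last by rewrite e'E Es.
  by rewrite /e'; case: (t == t0); nia.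
by rewrite ord_monomial_first e'E Es.
Qed.

(** The monomial already has order [- alpha l] at [p l], so only its pole at [p o] is in question.
    If h attains this order, [z h] has order b - 1 at [p l], and [regular_ord_zero] makes the pole
    of h at [p o] at least that of the monomial. *)
Lemma attained_other l : l != o -> r%:Z + b%:Z * e l = - (alpha l)%:Z ->
  attained alpha l <->
  a%:Z * r%:Z + b%:Z * \sum_(t < m | t != o) e t <= (alpha o)%:Z.
Proof.
move=> lo el; split=> [[h [h0 Lh hl]]|le]; last first.
  exists (monomial r e); split; first exact: monomial_neq0.
    by apply: rr_monomial => // t /eP/andP[].
  by rewrite ord_monomial_other.
have zl : p l (z h) = b.-1%:Z.
  by rewrite ord_z // ord_monomial_other // hl pu //; lia.
have Qu0 Q (Qo : Q != p o) : 0 <= Q u by have /andP[] := Qu Qo.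
have := regular_ord_zero genusF rato a0 b0 ab gammaE u0 (v0 l) ou (ov lo)
  Qu0 (Qv_ge0 lo) (pu lo) (pv lo) (z_neq0 h0) (z_regular h0 Lh) zl.
rewrite ord_z // ord_monomial_first ou.
have := rr_space_ord (p o) h0 Lh; rewrite coeff_divisor_of //.
by lia.
Qed.

End Reduced.

(** * The sets S_il in terms of the least exponents *)

Variable alpha : {ffun 'I_m -> nat}.

(** For i <= b, the least d with [alpha t < i + b * d]; its opposite is the least exponent e_t for r
    = b - i. *)
Let delta (i : nat) t : nat := ((alpha t + b - i) %/ b)%N.

Let delta_le i t d : (i <= b)%N ->
  (delta i t <= d)%N = (alpha t < i + b * d)%N.
Proof.
move=> ib; rewrite -ltnS ltn_divLR // mulSn [(d * b)%N]mulnC.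
by apply/idP/idP; lia.
Qed.

Let delta_bounds i : (0 < i <= b)%N -> forall t, t != o ->
  - (alpha t)%:Z <= (b - i)%N%:Z + b%:Z * - (delta i t)%:Z
    <= - (alpha t)%:Z + b%:Z - 1.
Proof.
move=> ib t _; have := divn_eq (alpha t + b - i) b; rewrite -/(delta i t).
have := ltn_pmod (alpha t + b - i) b0; rewrite [(_ * b)%N]mulnC mulrN.
by lia.
Qed.

Let sumZ (A : pred 'I_m) (d : 'I_m -> nat) :
  \sum_(t < m | A t) (d t)%:Z = (\sum_(t < m | A t) d t)%N%:Z.
Proof. by rewrite (big_morph Posz PoszD (erefl _)). Qed.

Let sum_delta i (A : pred 'I_m) :
  \sum_(t < m | A t) - (delta i t)%:Z = - (\sum_(t < m | A t) delta i t)%N%:Z.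
Proof. by rewrite sumrN sumZ. Qed.

(** Write alpha_o = a (b - i) - b (1 + j). With e_t = - [delta i t], the s of [attained_first] is
    (sum of the [delta i t]) - 1 - j. It is negative exactly when some d_t >= [delta i t] add up to
    j. *)
Lemma not_attained_first :
  ~ attained alpha o <->
  exists2 i, (1 <= i <= b.-1)%N & gap_set a b o i o alpha.
Proof.
rewrite /gap_set eqxx.
have crit i s : (0 < i <= b)%N ->
    (alpha o)%:Z = a%:Z * (b%:Z - i%:Z)
      - b%:Z * ((\sum_(t < m | t != o) delta i t)%N%:Z - s) ->
    attained alpha o <-> 0 <= s.
  move=> ib Es; apply: (attained_first (r := (b - i)%N) _ (delta_bounds ib)).
    by lia.
  by rewrite sum_delta Es -subzn; [ring | case/andP: ib].
split=> [noatt|[i ib [j [d [jm oE dP dj]]]]]; last first.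
  pose S := (\sum_(t < m | t != o) delta i t)%N.
  have Sj : (S <= j)%N.
    by rewrite -dj; apply: leq_sum => t to; rewrite delta_le ?dP //; lia.
  have ib' : (0 < i <= b)%N by lia.
  have [|+ _] := crit i (S%:Z - 1 - j%:Z) ib'; last by move=> /[apply]; lia.
  by rewrite oE -/S; congr (_ - _ * _); ring.
(* By Bezout, [km] inverts a modulo b, so [r] solves a r = alpha_o modulo b. *)
have [km kn E _] := egcdnP b a0.
pose r := ((km * alpha o) %% b)%N; pose i := (b - r)%N.
have rb : (r < b)%N by rewrite ltn_mod.
have ib : (0 < i <= b)%N by rewrite /i; lia.
have ar : ((a * r) %% b = alpha o %% b)%N.
  rewrite modnMmr mulnA [(a * km)%N]mulnC E (eqP ab) mulnDl mul1n.
  by rewrite mulnAC modnMDl.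
pose S := (\sum_(t < m | t != o) delta i t)%N.
pose q : int := (alpha o %/ b)%N%:Z - ((a * r) %/ b)%N%:Z.
have qE : (alpha o)%:Z = a%:Z * r%:Z + b%:Z * q.
  have := divn_eq (alpha o) b; have := divn_eq (a * r) b; rewrite ar /q.
  set x := (_ %/ b)%N; set y := (_ %/ b)%N; set c := (_ %% b)%N.
  by rewrite -PoszM => -> ->; rewrite !PoszD !PoszM; ring.
have ri : b%:Z - i%:Z = r%:Z by rewrite /i; lia.
have sq : q + S%:Z < 0.
  rewrite ltNge; apply/negP => sq; apply: noatt.
  by apply/(crit i (q + S%:Z) ib); rewrite // qE ri -/S; ring.
(* For r = 0, that is i = b, alpha_o would be b q with q < 0. *)
have r0 : (0 < r)%N.
  rewrite lt0n; apply/eqP => r0; move: qE; rewrite r0 mulr0 add0r.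
  have : b%:Z * q < 0; last by lia.
  by rewrite pmulr_rlt0 ?ltz_nat //; move: (q) sq; lia.
have [t0 t0o] := other_exists.
exists i; first by rewrite /i; move: (r) r0 rb; lia.
(* The slack between j and the sum of the [delta i t]; the membership condition is an equality, so
   [n] is added to one d_t. *)
pose n : nat := absz (q + S%:Z + 1).
have nE : n%:Z = - (q + S%:Z + 1) by rewrite /n; move: (q) (S) sq; lia.
pose j := (S + n)%N.
have jE : 1 + j%:Z = - q by rewrite /j PoszD nE; ring.
have oE : (alpha o)%:Z = a%:Z * (b%:Z - i%:Z) - b%:Z * (1 + j%:Z).
  by rewrite jE ri qE; ring.
exists j, (fun t => (delta i t + (t == t0) * n)%N); split=> //.
(* The bound on j amounts to the first coordinate being nonnegative. *)
- rewrite /jmax lez_divRL; last by rewrite ltz_nat.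
  have : 0 <= (alpha o)%:Z by [].
  by rewrite oE [b%:Z * (1 + _)]mulrDr mulr1 [j%:Z * _]mulrC; lia.
- by move=> t _; rewrite -delta_le ?leq_addr //; case/andP: ib.
rewrite big_split /=; congr (_ + _)%N.
rewrite (bigD1 t0) //= eqxx mul1n big1 ?addn0 // => t /andP[_ /negbTE->].
by rewrite mul0n.
Qed.

(** The residue of alpha_l fixes i, and alpha_l = i + b j means [delta i l] = j + 1. By
    [attained_other], non-attainment is alpha_o < a (b - i) - b (1 + j + sum of the other
    [delta i t]), which is the bound for the smallest possible d_1. *)
Lemma not_attained_other l : l != o ->
  ~ attained alpha l <->
  exists2 i, (1 <= i <= b.-1)%N & gap_set a b o i l alpha.
Proof.
move=> lo; rewrite /gap_set (negbTE lo).
have crit i : (0 < i <= b)%N -> (alpha l + b - i = b * delta i l)%N ->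
    attained alpha l <->
    a%:Z * (b%:Z - i%:Z) <=
    (alpha o)%:Z + b%:Z * ((delta i l)%:Z +
      (\sum_(t < m | (t != o) && (t != l)) delta i t)%N%:Z).
  move=> ib dl.
  rewrite (attained_other (r := (b - i)%N) _ (delta_bounds ib) lo); last 2 first.
  - by lia.
  - by rewrite mulrN -PoszM -dl; lia.
  rewrite sum_delta (bigD1 l) //= PoszD -subzn; last by case/andP: ib.
  by rewrite mulrN lerBlDr.
split=> [noatt|[i ib [j [d [jm lE dP oL dj]]]]]; last first.
  have ib' : (0 < i <= b)%N by lia.
  have dl : delta i l = j.+1.
    by rewrite /delta lE -addnA addKn mulnC addnC -mulSn mulnK.
  have [|+ _] := crit i ib'; first by rewrite dl lE mulnS; lia.
  move=> /[apply]; rewrite dl => oG.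
  have Sd : (\sum_(t < m | (t != o) && (t != l)) delta i t <=
             \sum_(t < m | (t != o) && (t != l)) d t)%N.
    apply: leq_sum => t /andP[to tl]; rewrite delta_le ?dP //.
    by case/andP: ib'.
  rewrite sumZ in dj.
  have : b%:Z * (j.+1%:Z + (\sum_(t < m | (t != o) && (t != l)) delta i t)%N%:Z)
         <= b%:Z * (1 + (d o)%:Z).
    by rewrite ler_wpM2l //; lia.
  by move: oG oL; lia.
(* [D] is alpha_l / b rounded up, so that alpha_l = i + b (D - 1) with 1 <= i <= b. *)
pose D := ((alpha l + b.-1) %/ b)%N; pose i := (alpha l + b - b * D)%N.
have E := divn_eq (alpha l + b.-1) b; rewrite -/D in E.
have R := ltn_pmod (alpha l + b.-1) b0.
have ib : (0 < i <= b)%N by rewrite /i; lia.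
have iE : (alpha l + b - i = D * b)%N by rewrite /i; lia.
have dl : delta i l = D by rewrite /delta iE mulnK.
have [|_ +] := crit i ib; first by rewrite iE dl mulnC.
move/(contra_not (P := _))/(_ noatt)/negP; rewrite -ltNge dl.
set S := (\sum_(t < m | _) _)%N => oL.
(* For i = b the strict inequality [oL] would have right-hand side 0 and a nonnegative left-hand
   side. *)
have ib1 : (i < b)%N.
  rewrite ltn_neqAle; case/andP: (ib) => _ ->; rewrite andbT; apply/eqP => ibE.
  by move: oL; rewrite ibE subrr mulr0; nia.
have D0 : (0 < D)%N by rewrite lt0n; apply/eqP => D0; move: ib1; rewrite /i D0; lia.
exists i; first by lia.
(* The value at [o] is forced by d_1 - sum d_t = j once the other d_t are least possible. *)
exists D.-1, (fun t => if t == o then (D.-1 + S)%N else delta i t).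
have oL' : (alpha o)%:Z < a%:Z * (b%:Z - i%:Z) - b%:Z * (1 + (D.-1 + S)%N%:Z).
  have -> : 1 + (D.-1 + S)%N%:Z = D%:Z + S%:Z by lia.
  by rewrite ltrBrDr.
rewrite eqxx; split=> //.
- rewrite /jmax lez_divRL; last by rewrite ltz_nat.
  have : 0 <= b%:Z * S%:Z by rewrite mulr_ge0.
  move: oL'; rewrite PoszD [b%:Z * (1 + _)]mulrDr [b%:Z * (_ + S%:Z)]mulrDr.
  by rewrite mulr1 [D.-1%:Z * _]mulrC; lia.
- by move: (i) ib iE ib1; rewrite -{1}(prednK D0) mulSn mulnC; lia.
- move=> t to tl; rewrite (negbTE to) -delta_le ?leqnn //; case/andP: ib => //.
rewrite sumZ PoszD.
rewrite (eq_bigr (delta i)) => [|t /andP[/negbTE-> _]//].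
by rewrite addrK.
Qed.

End Monomials.

(** * From the linear equivalences between the rational points to the gap set *)

Theorem proposition4p5
  (k : finFieldType) (F : fieldType) (iota : {rmorphism k -> F})
  (f g : {poly k}) (x y : F) (a b gamma : nat)
  (P : 'I_a.+1 -> place iota)
  (hirr : geom_irreducible iota)
  (hf : size f = a.+1) (hg : size g = b.+1) (hab : coprime a b)
  (hmodel : plane_model iota f g x y)
  (hgenus : has_genus iota gamma) (hgamma : (0 < gamma)%N)
  (hgammaE : gamma = ((a.-1 * b.-1) %/ 2)%N)
  (hPinj : injective P)
  (hPrat : forall i : 'I_a.+1, rational_point (P i))
  (hPa : lin_equiv (<< P ord0 >> *+ a) (\sum_(i < a.+1 | i != ord0) << P i >>))
  (hPb : forall i : 'I_a.+1, i != ord0 ->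
     lin_equiv (<< P ord0 >> *+ b) (<< P i >> *+ b))
  (hPbmin : forall c : nat, (0 < c)%N ->
     (forall i : 'I_a.+1, i != ord0 ->
       lin_equiv (<< P ord0 >> *+ c) (<< P i >> *+ c)) ->
     (b <= c)%N)
  (m : nat) (hm : (2 <= m)%N) (hma : (m <= a.+1)%N) (hq : (m <= #|k|)%N) :
  weierstrass_gaps (fun i : 'I_m => P (widen_ord hma i)) =
  \bigcup_(i in [set i : nat | (1 <= i <= b.-1)%N])
    \bigcup_(l in [set: 'I_m]) gap_set a b (Ordinal (ltnW hm)) i l.
Proof.
pose p (i : 'I_m) := P (widen_ord hma i).
pose o : 'I_m := Ordinal (ltnW hm).
have pinj : injective p by move=> i j /hPinj ij; apply/val_inj; have := congr1 val ij.
have po : p o = P ord0 by congr P; apply: val_inj.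
have gamma0 : (0 < a.-1 * b.-1)%N by move: hgamma; rewrite hgammaE; lia.
have a0 : (0 < a)%N by move: gamma0; rewrite muln_gt0 => /andP[]; lia.
have b0 : (0 < b)%N by move: gamma0; rewrite muln_gt0 => /andP[]; lia.
(* By [sum_div_mul] the product is even, so the halving in the genus formula is exact. *)
have gammaE : (gamma.*2 = a.-1 * b.-1)%N.
  by have := sum_div_mul a0 b0 hab; rewrite hgammaE => <-; rewrite -!muln2 mulnK.
(* The divisor of h is a P_1 - (P_2 + ... + P_(a+1)), so u is the inverse of h; likewise each v_t
   inverts the function given by [hPb]. *)
have [h h0 hE] := hPa.
have vP (t : 'I_m) : exists w : F, w != 0 /\ (t != o -> forall Q : place iota,
    Q w = b%:Z * (p t == Q)%:Z - b%:Z * (p o == Q)%:Z).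
  (* At [o] nothing but being nonzero is asked, and 1 makes the choice total. *)
  have [->|to] := eqVneq t o; first by exists 1; rewrite oner_neq0.
  have [|w w0 wE] := hPb (widen_ord hma t).
    by apply: contra_neq to => /(congr1 val) ?; apply: val_inj.
  exists w^-1; rewrite invr_eq0; split=> // _ Q; rewrite ordV // -wE po.
  by rewrite !coeff_point; case: ifP; case: ifP => ? ?; lia.
have [v vE] := choice vP.
have coeff_rest (Q : place iota) :
    coeff Q (\sum_(i < a.+1 | i != ord0) << P i >>
             : {freeg (place iota) / int}) =
    \sum_(i < a.+1 | i != ord0) (P i == Q)%:Z.
  by rewrite raddf_sum; apply: eq_bigr => i _ /=; rewrite coeffU mul1r natz.
have uE (Q : place iota) : Q h^-1 =
    \sum_(i < a.+1 | i != ord0) (P i == Q)%:Z - a%:Z * (P ord0 == Q)%:Z.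
  rewrite ordV // -hE coeff_rest coeff_point opprB.
  by case: (P ord0 == Q); rewrite ?mulr1 ?mulr0.
have uPi i : i != ord0 -> P i h^-1 = 1.
  move=> i0; rewrite uE (bigD1 i) //= eqxx big1 => [|j /andP[_ ji]].
    by rewrite (inj_eq hPinj) eq_sym (negbTE i0) mulr0 subr0 addr0.
  by rewrite (inj_eq hPinj) (negbTE ji).
have u0 : h^-1 != 0 by rewrite invr_eq0.
have v0 t : v t != 0 by case: (vE t).
have ou : p o h^-1 = - a%:Z.
  rewrite po uE big1 ?eqxx ?mulr1 ?add0r // => i i0.
  by rewrite (inj_eq hPinj) (negbTE i0).
have wo t : t != o -> widen_ord hma t != ord0.
  by move=> to; apply: contra_neq to => /(congr1 val) ?; apply: val_inj.
have pu t : t != o -> p t h^-1 = 1 by move=> to; apply/uPi/wo.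
have Qu (Q : place iota) : Q != p o -> 0 <= Q h^-1 <= 1.
  rewrite po eq_sym => Qo.
  have [[i iQ]|/forallNP PQ] := pselect (exists i, P i = Q).
    by rewrite -iQ uPi //; apply: contra_neq Qo => <-.
  rewrite uE (negbTE Qo) mulr0 subr0 big1 // => i _.
  by rewrite (_ : P i == Q = false) //; apply/eqP.
have Qv t (to : t != o) : forall Q : place iota,
  Q (v t) = b%:Z * (p t == Q)%:Z - b%:Z * (p o == Q)%:Z by case: (vE t) => _; apply.
have rato : rational_point (p o) by rewrite po.
have first := not_attained_first hgenus rato pinj hm a0 b0 hab gammaE u0 v0
  ou pu Qu Qv.
have other := not_attained_other hgenus rato pinj hm a0 b0 hab gammaE u0 v0
  ou pu Qu Qv.
have gapP alpha l : ~ attained p alpha l <->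
    exists2 i, (1 <= i <= b.-1)%N & gap_set a b o i l alpha.
  by have [->|lo] := eqVneq l o; [exact: first | exact: other].
apply/seteqP; split=> alpha.
  move=> /= /(contra_not (weierstrass_semigroupP o alpha pinj hq).2)/existsNP.
  by case=> l /gapP[i ib il]; exists i => //; exists l.
case=> i /= ib [l _ il] /(weierstrass_semigroupP o alpha pinj hq).1/(_ l).
by apply/gapP; exists i.
Qed.
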